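(* Let $S$ be a completely simple semigroup. The following are equivalent: (1) $S$ is f-noetherian; (2) $S$ is finitely connected; (3) $S$ is finitely generated (as a semigroup).
   Context: A right congruence on a semigroup $S$ is an equivalence relation $\rho$ on $S$ such that $(a,b)\in\rho$ implies $(as,bs)\in\rho$ for all $s\in S$. The right congruence generated by a set $X\subseteq S\times S$ is the smallest right congruence on $S$ containing $X$; a right congruence is finitely generated if it is generated by some finite set $X$. The index of an equivalence relation is the cardinality of its set of equivalence classes. A semigroup $S$ is f-noetherian if every right congruence of finite index on $S$ is finitely generated. A semigroup $S$ is finitely connected if the universal relation $S\times S$ is finitely generated as a right congruence on $S$. A completely simple semigroup is a simple semigroup containing a primitive idempotent (equivalently, one isomorphic to a Rees matrix semigroup $\mathcal{M}(G;I,J;P)$ over a group $G$). *)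

(* Defs.v *)
From mathcomp Require Import all_boot.
From mathcomp Require Import all_classical.

Set Implicit Arguments.
Unset Strict Implicit.
Unset Printing Implicit Defensive.

Local Open Scope classical_set_scope.
Local Open Scope group_scope.

Definition equivalence (T : Type) (rho : set (T * T)) : Prop :=
  [/\ forall a, rho (a, a),
      forall a b, rho (a, b) -> rho (b, a) &
      forall a b c, rho (a, b) -> rho (b, c) -> rho (a, c)].

Definition equiv_class (T : Type) (rho : set (T * T)) (a : T) : set T :=
  [set b | rho (a, b)].

Definition finite_index (T : Type) (rho : set (T * T)) : Prop :=
  finite_set (range (equiv_class rho)).

Definition right_congruence (S : semigroupType) (rho : set (S * S)) : Prop :=
  equivalence rho /\ forall a b s, rho (a, b) -> rho (a * s, b * s).

Definition right_congruence_gen (S : semigroupType) (X : set (S * S)) :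
    set (S * S) :=
  smallest (@right_congruence S) X.

Definition fg_right_congruence (S : semigroupType) (rho : set (S * S)) : Prop :=
  exists2 X : set (S * S), finite_set X & rho = right_congruence_gen X.

Definition f_noetherian (S : semigroupType) : Prop :=
  forall rho : set (S * S),
    right_congruence rho -> finite_index rho -> fg_right_congruence rho.

Definition finitely_connected (S : semigroupType) : Prop :=
  fg_right_congruence [set: S * S].

Definition subsemigroup (S : semigroupType) (A : set S) : Prop :=
  forall a b, A a -> A b -> A (a * b).

Definition subsemigroup_gen (S : semigroupType) (X : set S) : set S :=
  smallest (@subsemigroup S) X.

Definition fg_semigroup (S : semigroupType) : Prop :=
  exists2 X : set S, finite_set X & subsemigroup_gen X = [set: S].

Definition two_sided_ideal (S : semigroupType) (I : set S) : Prop :=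
  I !=set0 /\ forall a s, I a -> I (s * a) /\ I (a * s).

Definition simple_semigroup (S : semigroupType) : Prop :=
  forall I : set S, two_sided_ideal I -> I = [set: S].

Definition idempotent_elt (S : semigroupType) (e : S) : Prop := e * e = e.

(* Minimality for the natural order f <= e :<-> e * f = f * e = f among all
   idempotents: a possible zero need not be excluded here, because a simple
   semigroup with a zero is trivial. *)
Definition primitive_idempotent (S : semigroupType) (e : S) : Prop :=
  idempotent_elt e /\
  forall f : S, idempotent_elt f -> e * f = f -> f * e = f -> f = e.

Definition completely_simple (S : semigroupType) : Prop :=
  simple_semigroup S /\ exists e : S, primitive_idempotent e.

(* Main.v *)
From mathcomp Require Import all_boot.
From mathcomp Require Import all_classical.
Require Import Defs.

(** Two of the three implications are general facts about semigroups.  The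
    universal relation has one class, so an f-noetherian semigroup is finitely
    connected.  A finitely generated semigroup is f-noetherian by a
    Schreier-type argument: if [A] generates [S] and [r] picks representatives
    of the finitely many classes of [rho], then the pairs [(a, r a)] and
    [(c * a, r (c * a))], for [a] in [A] and [c] a representative, generate
    [rho], because they allow one to rewrite any product of generators into its
    representative from left to right ([fg_semigroup_f_noetherian]).

    The remaining implication uses complete simplicity only through the fact
    that every principal left ideal is minimal, in the form: every [s] can be
    recovered from [x * s] by a left multiplication
    ([completely_simple_left_division]).  It holds because [eSe] is a group for
    a primitive idempotent [e] and [S = SeS].

    Let a finite set [X] of pairs generate the universal relation, and let [A]
    be the finite set of all coordinates of [X] together with one more element.
    The only way to leave a nonempty subset of [S] along the generated relation
    is through some [(x, y)] in [X] or a right translate [(x * s, y * s)] of it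
    ([connected_invariant]).  For the right ideal generated by [A] this is
    impossible, so every [s] is some [k] in [A] or a right multiple of it.  Hence
    the finitely many elements [d x k] with [d x k * (x * k) = k], for [x] and [k]
    in [A], suffice to cancel every [x] in [A] from every product [x * s].  Now
    let [T] be the subsemigroup generated by [A] and these [d x k].  For [x] in
    [A] we get that [x * s] is in [T] exactly when [s] is, so the relation
    cannot leave [T] either, and [T = S]. *)

Set Implicit Arguments.
Unset Strict Implicit.
Unset Printing Implicit Defensive.

Local Open Scope classical_set_scope.
Local Open Scope group_scope.

Section Generation.
Variable S : semigroupType.
Implicit Types (X rho : set (S * S)) (A C : set S).

Lemma right_congruence_gen_congruence X :
  right_congruence (right_congruence_gen X).
Proof.
split; first split.
- by move=> a rho [[[refl _ _] _] _]; apply: refl.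
- move=> a b ab rho rhoX; have [[[_ sym _] _] _] := rhoX.
  exact: sym (ab _ rhoX).
- move=> a b c ab bc rho rhoX; have [[[_ _ trans] _] _] := rhoX.
  exact: trans (ab _ rhoX) (bc _ rhoX).
- move=> a b s ab rho rhoX; have [[_ mulr] _] := rhoX.
  exact: mulr (ab _ rhoX).
Qed.

Lemma sub_right_congruence_gen X : X `<=` right_congruence_gen X.
Proof. exact: sub_gen_smallest. Qed.

Lemma subsemigroup_gen_subsemigroup A : subsemigroup (subsemigroup_gen A).
Proof.
move=> a b Aa Ab M MA; have [mulM _] := MA.
exact: mulM (Aa _ MA) (Ab _ MA).
Qed.

Lemma sub_subsemigroup_gen A : A `<=` subsemigroup_gen A.
Proof. exact: sub_gen_smallest. Qed.

(** Generated elements are products [a1 * ... * an] bracketed to the left, so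
    an induction may append one generator at a time on the right. *)
Lemma subsemigroup_gen_ind A (P : S -> Prop) :
    (forall a, A a -> P a) ->
    (forall s a, P s -> A a -> P (s * a)) ->
  forall s, subsemigroup_gen A s -> P s.
Proof.
move=> P1 PM.
(* The subset of those [t] such that [P] is stable under appending [t] is
   needed next to [P] itself to obtain a subsemigroup. *)
pose Q := [set t | P t /\ forall s, P s -> P (s * t)].
have QA : subsemigroup_gen A `<=` Q.
  apply: smallest_sub => [t u [Pt PMt] [Pu PMu]|a Aa].
    by split=> [|s Ps]; [apply: PMu | rewrite mulgA; apply/PMu/PMt].
  by split=> [|s Ps]; [apply: P1 | apply: PM].
by move=> s /QA[].
Qed.

Lemma fg_semigroup_f_noetherian : fg_semigroup S -> f_noetherian S.
Proof.
move=> [A finA genA] rho rho_rc rho_fin.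
have [[refl sym trans] mulr] := rho_rc.
pose r a := choose (fun b => `[< rho (a, b) >]) a.
have rhor a : rho (a, r a).
  apply/asboolP; apply: (@chooseP _ (fun b => `[< rho (a, b) >])).
  exact/asboolP.
have eqr a b : rho (a, b) -> r a = r b.
  move=> ab; rewrite /r.
  rewrite (@eq_choose _ _ (fun c => `[< rho (b, c) >])); last first.
    move=> c; apply: asbool_equiv_eq; split; apply: trans => //.
    exact: sym.
  by apply: choose_id; apply/asboolP; [apply: sym|apply: refl].
have fin_r : finite_set (range r).
  have inj_class : {in range r &, injective (equiv_class rho)}.
    move=> _ _ /set_mem[a _ <-] /set_mem[b _ <-] E.
    have : equiv_class rho (r a) (r b) by rewrite E; apply: refl.
    move=> rab; apply: eqr; apply: (trans _ _ _ (rhor a) _).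
    by apply: (trans _ _ _ rab _); apply/sym/rhor.
  rewrite -(eq_finite_set (inj_card_eq inj_class)).
  by apply: sub_finite_set rho_fin => _ [a _ <-]; exists a.
pose B := A `|` [set c * a | c in range r & a in A].
exists [set (b, r b) | b in B].
  apply: finite_image; rewrite finite_setU; split=> //.
  exact: finite_image2.
rewrite eqEsubset; split; last first.
  by apply: smallest_sub => // _ [b _ <-].
set X := [set _ | _ in _].
have [[_ symX transX] mulrX] := right_congruence_gen_congruence X.
have XB b : B b -> right_congruence_gen X (b, r b).
  by move=> Bb; apply: sub_right_congruence_gen; exists b.
have Xr s : right_congruence_gen X (s, r s).
  have : subsemigroup_gen A s by rewrite genA.
  elim/subsemigroup_gen_ind: s / => [a Aa|s a Xs Aa].
    by apply: XB; left.
  rewrite (eqr (s * a) (r s * a)); last exact/mulr/rhor.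
  apply: (transX _ _ _ (mulrX _ _ a Xs) _); apply: XB; right.
  by exists (r s); [exists s | exists a].
move=> [a b] ab; apply: (transX _ _ _ (Xr a) _).
by rewrite (eqr a b ab); apply: symX (Xr b).
Qed.

Lemma f_noetherian_finitely_connected : f_noetherian S -> finitely_connected S.
Proof.
apply; first by split.
apply: (@sub_finite_set _ _ [set setT]); last exact: finite_set1.
by move=> _ [a _ <-]; apply/seteqP.
Qed.

(** The relation of having the same right translates in [C] is a right
    congruence, and two elements that it relates are both in [C] or both
    outside [C]. *)
Lemma connected_invariant X C :
    right_congruence_gen X = setT ->
    (forall x y, X (x, y) ->
       (C x <-> C y) /\ forall s, C (x * s) <-> C (y * s)) ->
  C !=set0 -> C = setT.
Proof.
move=> genX XC [c Cc].
pose rho := [set p : S * S |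
  (C p.1 <-> C p.2) /\ forall s, C (p.1 * s) <-> C (p.2 * s)].
have rho_rc : right_congruence rho.
  split; first split.
  - by [].
  - by move=> a b [/= ab abs]; split=> [|s] /=; apply: iff_sym.
  - move=> a b d [/= ab abs] [/= bd bds]; split=> [|s] /=.
      exact: iff_trans ab bd.
    exact: iff_trans (abs s) (bds s).
  - by move=> a b s [/= ab abs]; split=> [|t] /=; rewrite -?mulgA; apply: abs.
have rhoT : right_congruence_gen X `<=` rho.
  by apply: smallest_sub => // -[x y] /XC.
apply/seteqP; split=> // s _.
have [/= cs _] : rho (c, s) by apply: rhoT; rewrite genX.
exact/cs.
Qed.

(** The hypothesis says that every principal left ideal is minimal. *)
Lemma left_division_finitely_connected_fg :
    (forall x s : S, exists y, y * (x * s) = s) ->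
  finitely_connected S -> fg_semigroup S.
Proof.
move=> divS [X finX /esym genX].
have [S0|/set0P[e _]] := eqVneq [set: S] set0.
  exists set0 => //; apply/seteqP; split=> //.
  by rewrite S0; exact: sub0set.
(* The extra element [e] makes [A] nonempty when [X] is empty. *)
pose A := e |` (fst @` X `|` snd @` X).
have finA : finite_set A.
  by rewrite !finite_setU; do !split=> //; apply: finite_image.
have XA x y : X (x, y) -> A x /\ A y.
  by move=> Xxy; split; right; [left|right]; exists (x, y).
have Ae : A e by left.
have AS s : exists2 k, A k & s = k \/ exists u, s = k * u.
  pose C := [set t | exists2 k, A k & t = k \/ exists u, t = k * u].
  suff CT : C = setT by have : C s by rewrite CT.
  have CA k : A k -> C k by exists k => //; left.
  have CAM k u : A k -> C (k * u) by exists k => //; right; exists u.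
  apply: (connected_invariant genX) => [x y /XA[Ax Ay]|]; last first.
    by exists e; apply: CA.
  by split=> [|s']; split=> _; [apply: CA|apply: CA|apply: CAM|apply: CAM].
have [d dP] := @choice _ _ (fun (p : S * S) y => y * (p.1 * p.2) = p.2)
  (fun p => divS p.1 p.2).
pose B := A `|` d @` (A `*` A).
have finB : finite_set B.
  rewrite finite_setU; split=> //.
  by apply: finite_image; apply: finite_setX.
have TA x : A x -> subsemigroup_gen B x.
  by move=> Ax; apply: sub_subsemigroup_gen; left.
have TM := @subsemigroup_gen_subsemigroup B.
have TAM x s : A x -> subsemigroup_gen B (x * s) <-> subsemigroup_gen B s.
  move=> Ax; split=> [Txs|]; last by apply: TM (TA x Ax).
  have [k Ak sk] := AS s.
  have dxs : d (x, k) * (x * s) = s.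
    case: sk => [->|[u ->]]; first exact: dP (x, k).
    by rewrite [x * _]mulgA [LHS]mulgA (dP (x, k)).
  rewrite -dxs; apply: TM => //; apply: sub_subsemigroup_gen.
  by right; exists (x, k).
exists B => //; apply: (connected_invariant genX) => [x y /XA[Ax Ay]|].
  split=> [|s]; first by split=> _; apply: TA.
  exact: iff_trans (TAM x s Ax) (iff_sym (TAM y s Ay)).
by exists e; apply: TA.
Qed.

Lemma simple_factorization (a s : S) :
  simple_semigroup S -> exists u v, u * a * v = s.
Proof.
move=> simS; pose I := [set t | exists u v, u * a * v = t].
suff IT : I = setT by have : I s by rewrite IT.
apply: simS; split; first by exists (a * a * a), a, a.
move=> _ t [u [v <-]]; split; first by exists (t * u), v; rewrite !mulgA.
by exists u, (v * t); rewrite !mulgA.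
Qed.

(** Simplicity gives [u * (e * a * e) * v = e] with [u] and [v] in [eSe].  Then
    [v * u * (e * a * e)] is an idempotent below [e], so it equals [e]. *)
Lemma primitive_local_left_inverse (e a : S) :
  simple_semigroup S -> primitive_idempotent e -> exists g, g * (e * a * e) = e.
Proof.
move=> simS [ee prim_e]; set b := e * a * e.
have eb : e * b = b by rewrite /b !mulgA ee.
have be : b * e = b by rewrite /b -!mulgA ee.
have [u0 [v0 uv0]] := simple_factorization b e simS.
pose u := e * u0 * e; pose v := e * v0 * e.
have eu : e * u = u by rewrite /u !mulgA ee.
have ev : e * v = v by rewrite /v !mulgA ee.
have ubv : u * b * v = e.
  have -> : u * b * v = e * (u0 * (e * (b * e)) * v0) * e.
    by rewrite /u /v !mulgA.
  by rewrite be eb uv0 ee.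
clearbody u v b.
exists (v * u); apply: prim_e.
- rewrite /idempotent_elt.
  have -> : v * u * b * (v * u * b) = v * (u * b * v) * (u * b).
    by rewrite !mulgA.
  by rewrite ubv -mulgA [e * _]mulgA eu mulgA.
- by rewrite !mulgA ev.
- by rewrite -!mulgA be.
Qed.

(** Write [s] as [p * e * q].  The left inverse of [e * (x * p) * e] supplied by
    the previous lemma recovers [e] from [x * p * e], hence [s] from [x * s]. *)
Lemma completely_simple_left_division :
  completely_simple S -> forall x s : S, exists y, y * (x * s) = s.
Proof.
move=> [simS [e prim_e]] x s.
have [p [q <-]] := simple_factorization e s simS.
have [g ge] := primitive_local_left_inverse (x * p) simS prim_e.
exists (p * (g * e)).
have -> : p * (g * e) * (x * (p * e * q)) = p * (g * (e * (x * p) * e)) * q.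
  by rewrite !mulgA.
by rewrite ge.
Qed.

End Generation.

Theorem theorem7p4 (S : semigroupType) (hS : completely_simple S) :
  [<-> f_noetherian S; finitely_connected S; fg_semigroup S].
Proof.
tfae.
- exact: f_noetherian_finitely_connected.
- exact/left_division_finitely_connected_fg/completely_simple_left_division.
- exact: fg_semigroup_f_noetherian.
Qed.
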